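(* Let $p>0$ be a prime and $\nu\geq 0$ an integer. The image of the inclusion map $\Phi_\nu:R_\nu\to\prod_{i=0}^\nu\mathbb{Z}$ is the subring consisting of the elements of the form $(b_0,\ldots,b_\nu)$ with $b_j\equiv b_{j-1}$ modulo $p^j$ for $1\leq j\leq\nu$.
   Context: The convolution ring $R$ in characteristic $p$: let $k$ be a field of characteristic $p$ and consider the category of pairs $(V,\varphi)$, where $V$ is a finite-dimensional $k$-vector space and $\varphi$ is a nilpotent endomorphism. $R$ is the free abelian group on isomorphism classes of such pairs modulo the relations $[V]=[V']+[V'']$ coming from direct sum decompositions. As an abelian group it is free on the classes $f_n$, $n\geq 1$, of $k^n$ with the nilpotent Jordan block $J_n$ of size $n$. Multiplication is induced by sending $(V,\varphi),(V',\varphi')$ to $V\otimes_k V'$ with the endomorphism $\varphi\otimes\mathrm{id}+\mathrm{id}\otimes\varphi'$; the unit is $f_1=1$ and $R$ depends only on $p$. For $\nu\geq 0$, $R_\nu\subset R$ is the subgroup generated by $f_1,f_p,\ldots,f_{p^\nu}$, which is a subring. The map $\Phi_\nu:R_\nu\to\prod_{i=0}^\nu\mathbb{Z}$ is the injective ring homomorphism given on the $\mathbb{Z}$-basis by $\Phi_\nu(f_{p^i})=(0,\ldots,0,p^i,\ldots,p^i)$ with $i$ leading zero entries, $0\leq i\leq\nu$. *)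

(* Defs.v *)
From HB Require Import structures.
From mathcomp Require Import all_boot all_order all_algebra.
From mathcomp Require Import boolp.
From mathcomp Require Import mxtens monalg ring_quotient zify ring.

Set Implicit Arguments.
Unset Strict Implicit.
Unset Printing Implicit Defensive.

Import GRing.Theory.
Local Open Scope ring_scope.
Local Open Scope quotient_scope.

Section Subgroup.
Variable V : zmodType.

Definition subgroup_gen (S : V -> Prop) : {pred V} :=
  [pred x | `[< forall H : {pred V},
                  zmod_closed H -> (forall s, S s -> s \in H) -> x \in H >]].

Lemma subgroup_genP (S : V -> Prop) x :
  reflect (forall H : {pred V},
             zmod_closed H -> (forall s, S s -> s \in H) -> x \in H)
          (x \in subgroup_gen S).
Proof. exact: asboolP. Qed.

Lemma mem_subgroup_gen (S : V -> Prop) s : S s -> s \in subgroup_gen S.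
Proof. by move=> Ss; apply/subgroup_genP => H _; apply. Qed.

Lemma subgroup_gen_closed (S : V -> Prop) : zmod_closed (subgroup_gen S).
Proof.
split=> [|x y /subgroup_genP xS /subgroup_genP yS]; apply/subgroup_genP => H Hc HS.
  by case: Hc.
by case: (Hc) => _; apply; [apply: xS | apply: yS].
Qed.

HB.instance Definition _ S :=
  GRing.isZmodClosed.Build V (subgroup_gen S) (subgroup_gen_closed S).

End Subgroup.

Section NilpotentPairs.
Variable k : fieldType.

(* Up to isomorphism V = k^n, so phi is given by its matrix, acting on row
   vectors; this keeps the objects in a small type. *)
Record nilp_pair := NilpPair {
  npdim : nat;
  npmx : 'M[k]_npdim;
  npmxP : exists m, npmx ^+ m = 0 }.

HB.instance Definition _ := gen_eqMixin nilp_pair.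
HB.instance Definition _ := gen_choiceMixin nilp_pair.

Definition nilp_iso (V W : nilp_pair) : Prop :=
  exists (P : 'M[k]_(npdim V, npdim W)) (Q : 'M[k]_(npdim W, npdim V)),
    [/\ P *m Q = 1%:M, Q *m P = 1%:M & npmx V *m P = P *m npmx W].

Lemma nilp_iso_equiv : equiv_class_of (fun V W => `[< nilp_iso V W >]).
Proof.
split=> [V|V W|V U W].
- by apply/asboolP; exists 1%:M, 1%:M; rewrite !mulmx1 mul1mx.
- by apply/idP/idP=> /asboolP[P [Q [PQ QP PV]]]; apply/asboolP;
    exists Q, P; split=> //;
    rewrite -[LHS]mul1mx -QP -mulmxA [P *m (_ *m _)]mulmxA -PV -!mulmxA PQ mulmx1.
move=> /asboolP[P [Q [PQ QP PV]]] /asboolP[P' [Q' [PQ' QP' PV']]].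
apply/asboolP; exists (P *m P'), (Q' *m Q); split.
- by rewrite mulmxA -[P *m P' *m Q']mulmxA PQ' mulmx1.
- by rewrite mulmxA -[Q' *m Q *m P]mulmxA QP mulmx1.
by rewrite mulmxA PV -!mulmxA PV'.
Qed.

Canonical nilp_iso_rel := EquivRelPack nilp_iso_equiv.

Definition isoclass := {eq_quot nilp_iso_rel}.
HB.instance Definition _ := Choice.on isoclass.

Definition icls (V : nilp_pair) : isoclass := \pi_isoclass V.

Lemma iclsP V W : icls V = icls W <-> nilp_iso V W.
Proof. by split=> [/eqmodP/asboolP|VW]; last by apply/eqmodP/asboolP. Qed.

Lemma iso_repr V : nilp_iso (repr (icls V)) V.
Proof. by apply/iclsP; rewrite /icls reprK. Qed.

(* Isomorphisms coming from a relabelling of the standard bases. *)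
Lemma iso_reindex (V W : nilp_pair) (f : 'I_(npdim V) -> 'I_(npdim W)) g :
  cancel f g -> cancel g f ->
  (forall i j, npmx V i j = npmx W (f i) (f j)) -> nilp_iso V W.
Proof.
move=> fK gK e.
exists (\matrix_(i, j) (f i == j)%:R), (\matrix_(i, j) (g i == j)%:R).
split; apply/matrixP => i j; rewrite !mxE.
- rewrite (bigD1 (f i)) //= !mxE eqxx mul1r fK big1 ?addr0 //.
  by move=> l /negPf li; rewrite !mxE eq_sym li mul0r.
- rewrite (bigD1 (g i)) //= !mxE eqxx mul1r gK big1 ?addr0 //.
  by move=> l /negPf li; rewrite !mxE eq_sym li mul0r.
rewrite (bigD1 (g j)) //= !mxE gK eqxx mulr1 big1 ?addr0; last first.
  move=> l lj; rewrite !mxE; case: eqP => [fl|]; last by rewrite mulr0.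
  by rewrite -fl fK eqxx in lj.
rewrite (bigD1 (f i)) //= !mxE eqxx mul1r big1 ?addr0; last first.
  by move=> l /negPf li; rewrite !mxE eq_sym li mul0r.
by rewrite e gK.
Qed.

Lemma nilp0 n : exists m, (0 : 'M[k]_n) ^+ m = 0.
Proof. by exists 1; rewrite expr1. Qed.

Definition triv_pair n := NilpPair (nilp0 n).

Lemma block_diag_exp m n (A : 'M[k]_m) (B : 'M[k]_n) e :
  (block_mx A 0 0 B) ^+ e = block_mx (A ^+ e) 0 0 (B ^+ e).
Proof.
elim: e => [|e IH]; first by rewrite !expr0 -scalar_mx_block.
rewrite !exprS IH [LHS]mulmx_block !mul0mx !mulmx0 !addr0 !add0r.
by [].
Qed.

Lemma nilp_le n (A : 'M[k]_n) e m : A ^+ e = 0 -> (e <= m)%N -> A ^+ m = 0.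
Proof. by move=> A0 em; rewrite -(subnKC em) exprD A0 mul0r. Qed.

Lemma dsum_nilp (V W : nilp_pair) :
  exists m, (block_mx (npmx V) 0 0 (npmx W)) ^+ m = 0.
Proof.
case: V W => [v A [a A0]] [w B [b B0]] /=; exists (maxn a b).
rewrite block_diag_exp (nilp_le A0) ?leq_maxl // (nilp_le B0) ?leq_maxr //.
exact: block_mx0.
Qed.

Definition dsum (V W : nilp_pair) := NilpPair (dsum_nilp V W).

Lemma tens1 m n : (1%:M : 'M[k]_m) *t (1%:M : 'M[k]_n) = 1%:M.
Proof.
apply/matrixP => i j.
case: (mxtens_indexP i) => i1 i2; case: (mxtens_indexP j) => j1 j2.
by rewrite tensmxE !mxE (can_eq (@mxtens_indexK _ _)) xpair_eqE -natrM mulnb.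
Qed.

Lemma tens_expl m n (A : 'M[k]_m) e :
  (A *t (1%:M : 'M[k]_n)) ^+ e = A ^+ e *t 1%:M.
Proof.
elim: e => [|e IH]; first by rewrite !expr0 tens1.
by rewrite !exprS IH [LHS]tensmx_mul mulmx1.
Qed.

Lemma tens_expr m n (B : 'M[k]_n) e :
  ((1%:M : 'M[k]_m) *t B) ^+ e = 1%:M *t B ^+ e.
Proof.
elim: e => [|e IH]; first by rewrite !expr0 tens1.
by rewrite !exprS IH [LHS]tensmx_mul mulmx1.
Qed.

Lemma tensor_nilp (V W : nilp_pair) :
  exists m, (npmx V *t 1%:M + 1%:M *t npmx W) ^+ m = 0.
Proof.
case: V W => [v A [a A0]] [w B [b B0]] /=; exists (a + b)%N.
rewrite exprDn_comm; last first.
  by rewrite /GRing.comm [LHS]tensmx_mul [RHS]tensmx_mul !mulmx1 !mul1mx.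
apply: big1 => i _; rewrite tens_expl tens_expr.
have [bi|ib] := leqP b i; first by rewrite (nilp_le B0 bi) tensmx0 mulr0 mul0rn.
by rewrite (nilp_le A0) ?tens0mx ?mul0r ?mul0rn //; lia.
Qed.

(* phi (x) id + id (x) phi' on the tensor product, through the Kronecker product. *)
Definition tensor (V W : nilp_pair) := NilpPair (tensor_nilp V W).

Definition jordan_mx n : 'M[k]_n := \matrix_(i, j) (j == i.+1 :> nat)%:R.

Lemma jordan_exp n e i j : (jordan_mx n ^+ e) i j = (j == (i + e)%N :> nat)%:R.
Proof.
elim: e i j => [|e IH] i j; first by rewrite expr0 !mxE addn0 eq_sym.
rewrite exprS [LHS]mxE.
have [ni|ni] := ltnP i.+1 n.
  rewrite (bigD1 (Ordinal ni)) //= !mxE eqxx mul1r big1 ?addr0.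
    by rewrite IH /= addSnnS.
  move=> l li; rewrite !mxE; case: eqP => [h|_]; last by rewrite mul0r.
  by case/eqP: li; apply: val_inj.
rewrite big1 => [|l _].
  by case: eqP => // h; have := ltn_ord j; lia.
by rewrite !mxE; case: eqP => [h|_]; [have := ltn_ord l; lia | rewrite mul0r].
Qed.

Lemma jordan_expn n : jordan_mx n ^+ n = 0.
Proof.
apply/matrixP=> i j; rewrite jordan_exp mxE; case: eqP => // h.
by have := ltn_ord j; lia.
Qed.

Lemma jordan_nilp n : exists m, jordan_mx n ^+ m = 0.
Proof. by exists n; apply: jordan_expn. Qed.

Definition jordan n := NilpPair (jordan_nilp n).

Lemma iso_refl V : nilp_iso V V.
Proof. exact/iclsP. Qed.

Lemma iso_sym V W : nilp_iso V W -> nilp_iso W V.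
Proof. by move=> /iclsP VW; apply/iclsP. Qed.

Lemma iso_trans V W U : nilp_iso V W -> nilp_iso W U -> nilp_iso V U.
Proof. by move=> /iclsP VW /iclsP WU; apply/iclsP; rewrite VW. Qed.

Lemma tensor_iso V V' W W' :
  nilp_iso V V' -> nilp_iso W W' -> nilp_iso (tensor V W) (tensor V' W').
Proof.
move=> [P [Q [PQ QP e]]] [P' [Q' [PQ' QP' e']]].
exists (P *t P'), (Q *t Q'); split => /=.
- by rewrite tensmx_mul PQ PQ' tens1.
- by rewrite tensmx_mul QP QP' tens1.
by rewrite mulmxDl mulmxDr !tensmx_mul e e' !mul1mx !mulmx1.
Qed.

Lemma tensorC_iso V W : nilp_iso (tensor V W) (tensor W V).
Proof.
pose f m n (i : 'I_(m * n)) : 'I_(n * m) :=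
  mxtens_index ((mxtens_unindex i).2, (mxtens_unindex i).1).
have fK m n : cancel (f m n) (f n m).
  by move=> i; case: (mxtens_indexP i) => a b; rewrite /f !mxtens_indexK.
apply: (@iso_reindex (tensor V W) (tensor W V) (f _ _) (f _ _)) => //= i j.
case: (mxtens_indexP i) => i1 i2; case: (mxtens_indexP j) => j1 j2.
rewrite /f !mxtens_indexK /= mxE [RHS]mxE !tensmxE addrC.
by congr (_ + _); rewrite mulrC.
Qed.

Lemma tensorA_iso V W U :
  nilp_iso (tensor V (tensor W U)) (tensor (tensor V W) U).
Proof.
pose f l m n (i : 'I_(l * (m * n))) : 'I_(l * m * n) :=
  let: (a, b) := mxtens_unindex i in let: (b, c) := mxtens_unindex b in
  mxtens_index (mxtens_index (a, b), c).
pose g l m n (i : 'I_(l * m * n)) : 'I_(l * (m * n)) :=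
  let: (a, c) := mxtens_unindex i in let: (a, b) := mxtens_unindex a in
  mxtens_index (a, mxtens_index (b, c)).
have fE l m n a b c : f l m n (mxtens_index (a, mxtens_index (b, c))) =
                      mxtens_index (mxtens_index (a, b), c).
  by rewrite /f !mxtens_indexK.
have gE l m n a b c : g l m n (mxtens_index (mxtens_index (a, b), c)) =
                      mxtens_index (a, mxtens_index (b, c)).
  by rewrite /g !mxtens_indexK.
apply: (@iso_reindex (tensor V (tensor W U)) (tensor (tensor V W) U)
          (f _ _ _) (g _ _ _)) => /= [i|i|i j].
- case: (mxtens_indexP i) => a b; case: (mxtens_indexP b) => b1 c.
  by rewrite fE gE.
- case: (mxtens_indexP i) => a c; case: (mxtens_indexP a) => a1 b.
  by rewrite gE fE.
case: (mxtens_indexP i) => a b; case: (mxtens_indexP b) => b1 c.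
case: (mxtens_indexP j) => a' b'; case: (mxtens_indexP b') => b1' c'.
rewrite !fE !(mxE, tensmxE, mxtens_indexK) /=.
rewrite !(can_eq (@mxtens_indexK _ _)) !xpair_eqE.
rewrite mulrDl mulrDr !addrA -!mulrA -!natrM !mulnb !mulrA.
by congr (_ + _ * _); rewrite -natrM mulnb.
Qed.

Lemma tensor1_iso V : nilp_iso (tensor (jordan 1) V) V.
Proof.
pose f n (i : 'I_(1 * n)) : 'I_n := (mxtens_unindex i).2.
pose g n (i : 'I_n) : 'I_(1 * n) := mxtens_index (ord0, i).
apply: (@iso_reindex (tensor (jordan 1) V) V (@f _) (@g _)) => [i|i|i j].
- by case: (mxtens_indexP i) => a b; rewrite /f /g mxtens_indexK (ord1 a).
- by rewrite /f /g mxtens_indexK.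
case: (mxtens_indexP i) => i1 i2; case: (mxtens_indexP j) => j1 j2.
rewrite /f !mxtens_indexK /= mxE !tensmxE !mxE (ord1 i1) (ord1 j1) /=.
by rewrite mul0r add0r mul1r.
Qed.

Lemma tensorDl_iso V W U :
  nilp_iso (tensor (dsum V W) U) (dsum (tensor V U) (tensor W U)).
Proof.
pose f l m n (i : 'I_((l + m) * n)) : 'I_(l * n + m * n) :=
  let: (a, b) := mxtens_unindex i in
  match split a with
  | inl a => lshift _ (mxtens_index (a, b))
  | inr a => rshift _ (mxtens_index (a, b))
  end.
pose g l m n (i : 'I_(l * n + m * n)) : 'I_((l + m) * n) :=
  match split i with
  | inl i => let: (a, b) := mxtens_unindex i in mxtens_index (lshift _ a, b)
  | inr i => let: (a, b) := mxtens_unindex i in mxtens_index (rshift _ a, b)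
  end.
have fl l m n a b : f l m n (mxtens_index (lshift _ a, b)) =
                    lshift _ (mxtens_index (a, b)).
  by rewrite /f mxtens_indexK (unsplitK (inl a)).
have fr l m n a b : f l m n (mxtens_index (rshift _ a, b)) =
                    rshift _ (mxtens_index (a, b)).
  by rewrite /f mxtens_indexK (unsplitK (inr a)).
have gl l m n a b : g l m n (lshift _ (mxtens_index (a, b))) =
                    mxtens_index (lshift _ a, b).
  by rewrite /g (unsplitK (inl _)) mxtens_indexK.
have gr l m n a b : g l m n (rshift _ (mxtens_index (a, b))) =
                    mxtens_index (rshift _ a, b).
  by rewrite /g (unsplitK (inr _)) mxtens_indexK.
apply: (@iso_reindex (tensor (dsum V W) U) (dsum (tensor V U) (tensor W U))
          (f _ _ _) (g _ _ _)) => /= [i|i|i j].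
- case: (mxtens_indexP i) => a b; case: (split_ordP a) => a' ->.
    by rewrite fl gl.
  by rewrite fr gr.
- case: (split_ordP i) => i' ->; case: (mxtens_indexP i') => a b.
    by rewrite gl fl.
  by rewrite gr fr.
case: (mxtens_indexP i) => a b; case: (mxtens_indexP j) => a' b'.
case: (split_ordP a) => c ->; case: (split_ordP a') => c' ->;
  rewrite ?(fl, fr) mxE !tensmxE ?(block_mxEul, block_mxEur, block_mxEdl, block_mxEdr)
    [in RHS]mxE ?tensmxE ?mxE ?eq_lshift ?eq_rshift ?eq_lrshift ?eq_rlshift //;
  by rewrite ?mul0r ?addr0.
Qed.

Lemma iso_dim V W : nilp_iso V W -> npdim V = npdim W.
Proof.
move=> [P [Q [PQ QP _]]]; apply/eqP.
by rewrite eqn_leq (mulmx1_min PQ) (mulmx1_min QP).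
Qed.

Lemma iso_dim1 V : npdim V = 1%N -> nilp_iso V (jordan 1).
Proof.
case: V => n A Anil /= n1; subst n; have [m A0] := Anil.
suff -> : NilpPair Anil = jordan 1 by apply: iso_refl.
have Ae : A = jordan_mx 1.
  apply/matrixP=> i j; rewrite !mxE (ord1 i) (ord1 j) /=.
  have : (A 0 0) ^+ m = 0.
    by move: A0; rewrite [A]mx11_scalar -rmorphXn => /matrixP/(_ 0 0); rewrite !mxE.
  by move/eqP; rewrite expf_eq0 => /andP[_ /eqP].
by subst A; congr NilpPair; apply: Prop_irrelevance.
Qed.

Definition icmul (x y : isoclass) : isoclass := icls (tensor (repr x) (repr y)).

Lemma icmulE V W : icmul (icls V) (icls W) = icls (tensor V W).
Proof. by apply/iclsP; apply: tensor_iso; apply: iso_repr. Qed.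

Lemma icls_repr (x : isoclass) : icls (repr x) = x.
Proof. by rewrite /icls reprK. Qed.

Lemma icmulA : associative icmul.
Proof.
move=> x y z; rewrite -(icls_repr x) -(icls_repr y) -(icls_repr z) !icmulE.
exact/iclsP/tensorA_iso.
Qed.

Lemma icmulC : commutative icmul.
Proof.
move=> x y; rewrite -(icls_repr x) -(icls_repr y) !icmulE.
exact/iclsP/tensorC_iso.
Qed.

Lemma icmul1 : left_id (icls (jordan 1)) icmul.
Proof. by move=> x; rewrite -(icls_repr x) icmulE; apply/iclsP/tensor1_iso. Qed.

Lemma icmulr1 : right_id (icls (jordan 1)) icmul.
Proof. by move=> x; rewrite icmulC icmul1. Qed.

Lemma icmul_unit x y :
  icmul x y = icls (jordan 1) -> x = icls (jordan 1) /\ y = icls (jordan 1).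
Proof.
move=> /iclsP/iso_dim/eqP; rewrite /= muln_eq1 => /andP[/eqP dx /eqP dy].
by rewrite -(icls_repr x) -(icls_repr y); split; apply/iclsP/iso_dim1.
Qed.

HB.instance Definition _ := Choice_isMonomialDef.Build isoclass
  icmulA icmul1 icmulr1 icmul_unit.
HB.instance Definition _ := MonomialDef_isConomialDef.Build isoclass icmulC.

(* The free abelian group on isomorphism classes; as isomorphism classes form a
   commutative monoid under the tensor product, it is a ring. *)
Local Notation freeR := {malg int[isoclass]}.

Definition dsum_rel (x : freeR) : Prop :=
  exists V W, x = << icls (dsum V W) >> - (<< icls V >> + << icls W >>).

Definition dsum_ideal : {pred freeR} := subgroup_gen dsum_rel.

Definition iso_additive (h : nilp_pair -> int) :=
  (forall V W, nilp_iso V W -> h V = h W) /\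
  (forall V W, h (dsum V W) = h V + h W).

Definition ilift (h : nilp_pair -> int) : freeR -> int :=
  mmap idfun (fun x : isoclass => h (repr x)).

Lemma ilift_is_additive h : zmod_morphism (ilift h).
Proof. exact: mmap_is_additive. Qed.
HB.instance Definition _ h :=
  GRing.isZmodMorphism.Build freeR int (ilift h) (ilift_is_additive h).

Lemma iliftE h V : iso_additive h -> ilift h << icls V >> = h V.
Proof.
move=> [hi _]; rewrite /ilift mmapU /= mul1r; apply: hi; exact: iso_repr.
Qed.

Lemma ilift_ideal h x : iso_additive h -> x \in dsum_ideal -> ilift h x = 0.
Proof.
move=> ha /subgroup_genP/(_ [pred x | ilift h x == 0]) xI.
apply/eqP; apply: xI; last first.
  move=> _ [V [W ->]]; rewrite inE raddfB raddfD /= !iliftE //.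
  by case: ha => _ ->; rewrite subrr.
split=> [|y z]; rewrite !inE ?raddf0 // => /eqP y0 /eqP z0.
by rewrite raddfB /= y0 z0 subrr.
Qed.

Lemma malg_ind (H : {pred freeR}) :
  zmod_closed H -> (forall V, << icls V >> \in H) -> forall x, x \in H.
Proof.
move=> [H0 HB] Hg x.
have HN y : y \in H -> - y \in H by move=> yH; rewrite -sub0r HB.
have HD y z : y \in H -> z \in H -> y + z \in H.
  by move=> yH zH; rewrite -[z]opprK HB // HN.
have HMn y n : y \in H -> y *+ n \in H.
  by move=> yH; elim: n => [|n IH]; rewrite ?mulr0n // mulrS HD.
rewrite (monalgE x); apply: (big_ind (fun y => y \in H)) => // c _.
have -> : << x@_c *g c >> = << icls (repr c) >> *~ x@_c :> freeR.
  rewrite icls_repr; apply/malgP => c'.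
  by rewrite raddfMz /= !mcoeffU; case: eqP; rewrite ?mulr1n ?mulr0n ?intz ?mul0rz.
by case: (x@_c) => n; rewrite ?NegzE ?mulrNz -?pmulrn ?HN ?HMn.
Qed.

Lemma dsum_idealMr a u : u \in dsum_ideal -> a * u \in dsum_ideal.
Proof.
move=> uI; pose H := [pred a : freeR | a * u \in dsum_ideal].
have [I0 IB] := subgroup_gen_closed dsum_rel.
suff : a \in H by [].
apply: malg_ind => [|V]; rewrite ?inE.
  split=> [|x y]; first by rewrite inE mul0r.
  by rewrite !inE mulrBl; apply: IB.
move/subgroup_genP: uI => /(_ [pred u | << icls V >> * u \in dsum_ideal]).
apply; last first.
  move=> _ [W [U ->]]; rewrite inE mulrBr mulrDr.
  have E X Y : << icls X >> * << icls Y >> = << icls (tensor Y X) >> :> freeR.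
    by rewrite malgM_def fgmulUU mulr1 [mmul _ _]icmulC -icmulE.
  rewrite !E; apply: mem_subgroup_gen; exists (tensor W V), (tensor U V).
  by congr (<< _ >> - _); apply/iclsP/tensorDl_iso.
split=> [|x y]; first by rewrite inE mulr0.
by rewrite !inE mulrBr; apply: IB.
Qed.

Lemma dsum_idealr_closed : idealr_closed dsum_ideal.
Proof.
have [I0 IB] := subgroup_gen_closed dsum_rel.
split=> [//||a u v uI vI].
  have dim_add : iso_additive (fun V => (npdim V)%:Z).
    by split=> [V W /iso_dim ->|V W] //=; rewrite PoszD.
  apply/negP => /(ilift_ideal dim_add).
  by rewrite -[1]/(<< icls (jordan 1) >>) iliftE.
rewrite -[v]opprK; apply: (IB); first exact: dsum_idealMr.
by rewrite -sub0r; apply: (IB).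
Qed.

HB.instance Definition _ :=
  isIdealr.Build freeR dsum_ideal dsum_idealr_closed.

Definition conv_ring := {ideal_quot dsum_ideal}.
HB.instance Definition _ := GRing.ComNzRing.on conv_ring.

Definition cls (V : nilp_pair) : conv_ring :=
  \pi_{ideal_quot dsum_ideal} << icls V >>.

(* The class of J_n; f_ 0 = 0 is the class of the zero space. *)
Definition f_ (n : nat) : conv_ring := cls (jordan n).

Lemma f_1 : f_ 1 = 1.
Proof. by rewrite -(rmorph1 \pi_{ideal_quot dsum_ideal}). Qed.

Lemma cls_iso V W : nilp_iso V W -> cls V = cls W.
Proof. by move=> /iclsP VW; rewrite /cls VW. Qed.

Lemma cls_dsum V W : cls (dsum V W) = cls V + cls W.
Proof.
rewrite /cls -[RHS](raddfD \pi_{ideal_quot dsum_ideal}).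
apply/eqP; rewrite -Quotient.idealrBE.
by apply: mem_subgroup_gen; exists V, W.
Qed.

Lemma cls_tensor V W : cls (tensor V W) = cls V * cls W.
Proof.
rewrite /cls -[RHS](rmorphM \pi_{ideal_quot dsum_ideal}); congr (\pi _).
by rewrite malgM_def fgmulUU mulr1 -icmulE.
Qed.

Lemma cls_triv a : cls (triv_pair a) = a%:R.
Proof.
elim: a => [|a IH].
  apply: (@addrI _ (cls (triv_pair 0))); rewrite addr0 -cls_dsum.
  by apply: cls_iso; apply: (@iso_reindex (dsum (triv_pair 0) (triv_pair 0)) (triv_pair 0) id id)
    => //= -[].
have -> : cls (triv_pair a.+1) = cls (dsum (jordan 1) (triv_pair a)).
  apply: cls_iso; apply: (@iso_reindex (triv_pair a.+1)
    (dsum (jordan 1) (triv_pair a)) id id) => //= i j.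
  rewrite mxE; case: (split_ordP (i : 'I_(1 + a))) => i' ->;
    case: (split_ordP (j : 'I_(1 + a))) => j' ->;
    rewrite ?(block_mxEul, block_mxEur, block_mxEdl, block_mxEdr) !mxE //.
  by rewrite (ord1 j').
by rewrite cls_dsum IH -/(f_ 1) f_1 mulrS.
Qed.

(* J_a (x) 1 + 1 (x) J_b is conjugate to 1 (x) J_b when a <= b = p^j. *)
Section Straighten.
Variables (p : nat).
Hypothesis pchark : p \in [pchar k].

Definition lowmx b l : 'M[k]_b :=
  \matrix_(i, j) ((-1) ^+ l * 'C(i, l)%:R *+ (i == (j + l)%N :> nat)).

Lemma bin_pchar e l : (0 < l < p ^ e)%N -> 'C(p ^ e, l)%:R = 0 :> k.
Proof.
move=> /andP[l0 le]; have pp := pcharf_prime pchark.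
apply/eqP; rewrite -(dvdn_pcharf pchark).
case: l l0 le => // l _ le; have := mul_bin_diag (p ^ e) l.
move=> /(congr1 (dvdn (p ^ e))); rewrite dvdn_mulr // => /esym.
have [//|pC] := boolP (p %| 'C(p ^ e, l.+1))%N.
rewrite Gauss_dvdl; first by move/(dvdn_leq (ltn0Sn l)); rewrite leqNgt le.
by rewrite coprimeXl // prime_coprime.
Qed.

Lemma lowmx0 b : lowmx b 0 = 1%:M.
Proof.
by apply/matrixP => i j; rewrite !mxE bin0 expr0 mul1r addn0 -val_eqE.
Qed.

Lemma lowmxJ b l i j : (lowmx b l.+1 *m jordan_mx b) i j =
  (-1) ^+ l.+1 * 'C(i, l.+1)%:R *+ (i == (j + l)%N :> nat).
Proof.
rewrite mxE; case: (posnP j) => [j0|jp].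
  rewrite big1 => [|s _]; last by rewrite !mxE j0 /= mulr0.
  by case: eqP => [il|]; rewrite ?mulr0n // bin_small ?mulr0 ?mul0rn //; lia.
have j1 : (j.-1 < b)%N by have := ltn_ord j; lia.
rewrite (bigD1 (Ordinal j1)) //= !mxE /= prednK // eqxx mulr1 big1 ?addr0.
  by congr (_ *+ nat_of_bool (_ == _)); lia.
move=> s sj; rewrite !mxE; case: (nat_of_ord j =P s.+1) => [h|_]; last by rewrite mulr0.
by case/eqP: sj; apply: val_inj => /=; rewrite h.
Qed.

Lemma Jlowmx e l i j : (l.+1 < p ^ e)%N ->
  (jordan_mx (p ^ e) *m lowmx _ l.+1) i j =
  (-1) ^+ l.+1 * 'C(i.+1, l.+1)%:R *+ (i == (j + l)%N :> nat).
Proof.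
move=> le; rewrite mxE; have [ni|ni] := ltnP i.+1 (p ^ e).
  rewrite (bigD1 (Ordinal ni)) //= !mxE /= eqxx mul1r big1 ?addr0.
    by congr (_ *+ nat_of_bool _); apply/eqP/eqP; lia.
  move=> s si; rewrite !mxE; case: eqP => [h|_]; last by rewrite mul0r.
  by case/eqP: si; apply: val_inj.
rewrite big1 => [|s _].
  have -> : i.+1 = (p ^ e)%N by apply/eqP; rewrite eqn_leq ltn_ord.
  by rewrite bin_pchar // mulr0 mul0rn.
by rewrite !mxE; case: eqP => [h|_]; [have := ltn_ord s; lia | rewrite mul0r].
Qed.

Lemma lowmx_comm e l : (l.+1 < p ^ e)%N ->
  lowmx (p ^ e) l.+1 *m jordan_mx _ =
  jordan_mx _ *m lowmx _ l.+1 + lowmx _ l.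
Proof.
move=> le; apply/matrixP => i j; rewrite lowmxJ [RHS]mxE Jlowmx // mxE -mulrnDl.
congr (_ *+ _); rewrite binS natrD exprS; ring.
Qed.

Lemma tensmxDr m n (A : 'M[k]_m) (B C : 'M[k]_n) :
  A *t (B + C) = A *t B + A *t C.
Proof. by apply/matrixP => i j; rewrite !mxE mulrDr. Qed.

Lemma straighten a e : (0 < a <= p ^ e)%N ->
  nilp_iso (tensor (jordan a) (jordan (p ^ e)))
           (tensor (triv_pair a) (jordan (p ^ e))).
Proof.
case: a => [//|a] /andP[_ ae]; set b := (p ^ e)%N.
pose J := jordan_mx a.+1.
pose P : 'M[k]_(a.+1 * b) := \sum_(l < a.+1) J ^+ l *t lowmx b l.
pose Y : 'M[k]_(a.+1 * b) := J *t 1%:M.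
pose Z : 'M[k]_(a.+1 * b) := \sum_(l < a) J ^+ l *t lowmx b l.+1.
have PE : P = 1 + Y * Z.
  rewrite /P big_ord_recl expr0 lowmx0 tens1; congr (_ + _).
  rewrite mulr_sumr; apply: eq_bigr => l _.
  by rewrite [RHS]tensmx_mul mul1mx exprS.
have YZ : GRing.comm Y Z.
  rewrite /GRing.comm mulr_sumr mulr_suml; apply: eq_bigr => l _.
  by rewrite [LHS]tensmx_mul [RHS]tensmx_mul mul1mx mulmx1 -[LHS]/(J * _ *t _) -exprS exprSr.
have X0 : (Y * Z) ^+ a.+1 = 0.
  by rewrite exprMn_comm // tens_expl jordan_expn tens0mx mul0r.
pose Q := \sum_(i < a.+1) (- (Y * Z)) ^+ i.
have PQ : P *m Q = 1%:M.
  have := subrX1 (- (Y * Z)) a.+1; rewrite exprNn X0 mulr0 sub0r -/Q.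
  rewrite -opprD mulNr => /oppr_inj; rewrite addrC -PE => /esym.
  exact.
exists P, Q; split=> //; first exact: mulmx1C.
rewrite /= tens0mx add0r mulmxDl /P.
rewrite -[X in X + _]/(Y * _) -[X in _ + X]/(_ * _) -[RHS]/(_ * _) !mulr_sumr mulr_suml.
rewrite big_ord_recr [X in _ + X + _]tensmx_mul -[(_ *m _) in X in _ + X + _]/(_ * _).
rewrite -exprS jordan_expn tens0mx addr0.
rewrite [X in _ + X]big_ord_recl [RHS]big_ord_recl addrCA; congr (_ + _).
  rewrite expr0 lowmx0 tens1 [LHS]mulr1 [RHS]mul1r. by [].
rewrite -big_split; apply: eq_bigr => l _ /=.
rewrite [X in X + _]tensmx_mul [X in _ + X]tensmx_mul [RHS]tensmx_mul !mul1mx mulmx1.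
rewrite -[X in X *t _ + _]/(_ * _) -exprS.
rewrite lowmx_comm; last by have := ltn_ord l; lia.
by rewrite tensmxDr addrC.
Qed.

Lemma f_mul i j : (i <= j)%N -> f_ (p ^ i) * f_ (p ^ j) = f_ (p ^ j) *+ p ^ i.
Proof.
move=> ij; have pp := prime_gt0 (pcharf_prime pchark).
rewrite /f_ -cls_tensor (cls_iso (straighten _)) ?cls_tensor ?cls_triv ?mulr_natl //.
by rewrite expn_gt0 pp leq_pexp2l.
Qed.

End Straighten.

(* Linear independence of the Jordan blocks, by the ranks of phi^n. *)
Lemma rank_iso_additive n : iso_additive (fun V : nilp_pair => (\rank (npmx V ^+ n))%:Z).
Proof.
split=> [V W [P [Q [PQ QP e]]]|V W]; last first.
  by rewrite /= block_diag_exp rank_diag_block_mx PoszD.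
have en : npmx V ^+ n *m P = P *m npmx W ^+ n.
  elim: n => [|n IH]; first by rewrite !expr0 mulmx1 mul1mx.
  by rewrite !exprS -[LHS]mulmxA IH !mulmxA e.
have uP : row_free P by apply/row_freeP; exists Q.
have fP : row_full P by apply/row_fullP; exists Q.
congr Posz; rewrite -(mxrankMfree _ uP) en.
by rewrite (eqmxMfull _ fP).
Qed.

Lemma f_indep n (m : 'I_n -> nat) (c : 'I_n -> int) :
  {homo m : i j / (i < j)%N} -> (forall i, 0 < m i)%N ->
  \sum_i f_ (m i) *~ c i = 0 -> forall i, c i = 0.
Proof.
move=> m_lt m_gt0 fc0 i0; apply/eqP/negPn/negP => ci0.
case: (@arg_maxnP _ i0 (fun i => c i != 0) (@nat_of_ord n) ci0) => i ci imax.
pose x : {malg int[isoclass]} := \sum_i << icls (jordan (m i)) >> *~ c i.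
have xI : x \in dsum_ideal.
  rewrite -[x]subr0 Quotient.idealrBE; apply/eqP; rewrite raddf0 -[RHS]fc0 raddf_sum.
  by apply: eq_bigr => j _; rewrite raddfMz.
have := ilift_ideal (rank_iso_additive (m i).-1) xI.
rewrite raddf_sum (bigD1 i) //= big1 ?addr0 => [|j ji].
  rewrite raddfMz /= iliftE //; last exact: rank_iso_additive.
  move/eqP; rewrite -mulrzr mulf_eq0 intz (negPf ci) orbF.
  rewrite eqz_nat mxrank_eq0 => /eqP/matrixP.
  have mi := m_gt0 i; have mi' : ((m i).-1 < m i)%N by rewrite prednK.
  move=> /(_ (Ordinal mi) (Ordinal mi')); rewrite jordan_exp !mxE eqxx.
  by move/eqP; rewrite oner_eq0.
rewrite raddfMz /= iliftE //; last exact: rank_iso_additive.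
have [ij|ij|ij] := ltngtP i j.
- have [->|cj] := eqVneq (c j) 0; first by rewrite mulr0z.
  by have /= := imax _ cj; rewrite /geq /= leqNgt ij.
- have mji : (m j <= (m i).-1)%N by rewrite -ltnS prednK // m_lt.
  by rewrite (nilp_le (jordan_expn (m j)) mji) mxrank0 mul0rz.
by rewrite (val_inj ij) eqxx in ji.
Qed.

End NilpotentPairs.

Section SubringRnu.
Variables (k : fieldType) (p nu : nat).

Definition Rnu_pred : {pred conv_ring k} :=
  subgroup_gen (fun x => exists2 i, (i <= nu)%N & x = f_ k (p ^ i)).

Lemma Rnu_predP x :
  x \in Rnu_pred <->
  exists c : {ffun 'I_nu.+1 -> int}, x = \sum_(i < nu.+1) f_ k (p ^ i) *~ c i.
Proof.
split=> [/subgroup_genP xR|[c ->]]; last first.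
  have [R0 RB] := subgroup_gen_closed
    (fun x => exists2 i, (i <= nu)%N & x = f_ k (p ^ i)).
  apply: rpred_sum => i _; apply: rpredMz; apply: mem_subgroup_gen.
  by exists i; rewrite // -ltnS.
pose H := [pred x | `[< exists c : {ffun 'I_nu.+1 -> int},
                          x = \sum_(i < nu.+1) f_ k (p ^ i) *~ c i >]].
apply/asboolP; apply: (xR H).
  split=> [|y z /asboolP[c ->] /asboolP[d ->]]; apply/asboolP.
    by exists 0; rewrite big1 // => i _; rewrite ffunE mulr0z.
  exists (c - d); rewrite -sumrB; apply: eq_bigr => i _.
  by rewrite !ffunE mulrzBr.
move=> _ [i inu ->]; apply/asboolP; have i_lt : (i < nu.+1)%N by [].
exists [ffun j => (j == Ordinal i_lt)%:R].
rewrite (bigD1 (Ordinal i_lt)) //= ffunE eqxx big1 ?addr0 // => j ji.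
by rewrite ffunE (negPf ji).
Qed.

Lemma Rnu_subring_closed : p \in [pchar k] -> subring_closed Rnu_pred.
Proof.
move=> pchark; split.
- by apply: mem_subgroup_gen; exists 0%N; rewrite // expn0 f_1.
- by move=> x y xR yR; apply: rpredB.
move=> _ _ /Rnu_predP[c ->] /Rnu_predP[d ->].
rewrite mulr_suml; apply: rpred_sum => i _.
rewrite mulr_sumr; apply: rpred_sum => j _.
rewrite mulrzAl mulrzAr; do 2!apply: rpredMz.
wlog ij : i j / (i <= j)%N.
  by move=> H; have [|/ltnW] := leqP i j; [|rewrite mulrC]; apply: H.
rewrite (f_mul pchark ij); apply: rpredMn; apply: mem_subgroup_gen.
by exists j; rewrite // -ltnS.
Qed.

(* The characteristic only matters for closure under multiplication, hence the
   unused parameter: it lets the ring structure below be inferred. *)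
Record Rnu (pchark : p \in [pchar k]) := MkRnu {
  Rnu_val :> conv_ring k;
  RnuP : Rnu_val \in Rnu_pred }.

Variable pchark : p \in [pchar k].
Notation R_ := (Rnu pchark).

HB.instance Definition _ := [isSub of R_ for @Rnu_val pchark].
HB.instance Definition _ := [Choice of R_ by <:].
HB.instance Definition _ :=
  GRing.SubChoice_isSubComNzRing.Build (conv_ring k) Rnu_pred R_
    (Rnu_subring_closed pchark).

Lemma f_Rnu_subproof (i : 'I_nu.+1) : f_ k (p ^ i) \in Rnu_pred.
Proof. by apply: mem_subgroup_gen; exists i; rewrite // -ltnS. Qed.

Definition f_Rnu (i : 'I_nu.+1) : R_ := MkRnu pchark (f_Rnu_subproof i).

Lemma Rnu_basis (x : R_) :
  exists! c : {ffun 'I_nu.+1 -> int}, x = \sum_i f_Rnu i *~ c i.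
Proof.
have [c xc] := (Rnu_predP _).1 (RnuP x).
have vE (d : {ffun 'I_nu.+1 -> int}) :
    val (\sum_i f_Rnu i *~ d i) = \sum_(i < nu.+1) f_ k (p ^ i) *~ d i.
  by rewrite raddf_sum; apply: eq_bigr => i _; rewrite raddfMz.
exists c; split=> [|d xd]; first by apply: val_inj; rewrite vE.
apply/ffunP => i; apply/eqP; rewrite -subr_eq0; apply/eqP; move: i.
have p1 := prime_gt1 (pcharf_prime pchark).
apply: (@f_indep k _ (fun i : 'I_nu.+1 => p ^ i)%N).
- by move=> i j ij; rewrite ltn_exp2l.
- by move=> i; rewrite expn_gt0 ltnW.
under eq_bigr do rewrite mulrzBr.
by rewrite sumrB -xc -vE -xd subrr.
Qed.

Definition Rnu_coord (x : R_) : {ffun 'I_nu.+1 -> int} :=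
  sval (cid (Rnu_basis x)).

Lemma Rnu_coordE x : x = \sum_i f_Rnu i *~ Rnu_coord x i.
Proof. by case: (svalP (cid (Rnu_basis x))). Qed.

Lemma Rnu_coord_uniq x (c : {ffun 'I_nu.+1 -> int}) :
  x = \sum_i f_Rnu i *~ c i -> Rnu_coord x = c.
Proof. by case: (svalP (cid (Rnu_basis x))) => _; apply. Qed.

Definition Phi_basis (i : 'I_nu.+1) : {ffun 'I_nu.+1 -> int} :=
  [ffun j : 'I_nu.+1 => if (i <= j)%N then (p ^ i)%N%:Z else 0].

Definition Phi (x : R_) : {ffun 'I_nu.+1 -> int} :=
  \sum_i Phi_basis i *~ Rnu_coord x i.

Lemma Phi_f i : Phi (f_Rnu i) = Phi_basis i.
Proof.
rewrite /Phi (@Rnu_coord_uniq _ [ffun j => (j == i)%:R]).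
  rewrite (bigD1 i) //= ffunE eqxx mulr1z big1 ?addr0 // => j ji.
  by rewrite ffunE (negPf ji) mulr0z.
rewrite (bigD1 i) //= ffunE eqxx mulr1z big1 ?addr0 // => j ji.
by rewrite ffunE (negPf ji) mulr0z.
Qed.

Lemma Phi_is_zmod_morphism : zmod_morphism Phi.
Proof.
move=> x y; rewrite /Phi (@Rnu_coord_uniq _ (Rnu_coord x - Rnu_coord y)).
  by rewrite -sumrB; apply: eq_bigr => i _; rewrite !ffunE mulrzBr.
rewrite {1}(Rnu_coordE x) {1}(Rnu_coordE y) -sumrB.
by apply: eq_bigr => i _; rewrite !ffunE mulrzBr.
Qed.
HB.instance Definition _ :=
  GRing.isZmodMorphism.Build R_ {ffun 'I_nu.+1 -> int} Phi Phi_is_zmod_morphism.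

Lemma Phi_is_monoid_morphism : monoid_morphism Phi.
Proof.
split.
  have -> : 1 = f_Rnu ord0 by apply: val_inj; rewrite /= expn0 f_1.
  by rewrite Phi_f; apply/ffunP => j; rewrite !ffunE expn0.
move=> x y; rewrite (Rnu_coordE x) (Rnu_coordE y).
rewrite mulr_suml !raddf_sum mulr_suml; apply: eq_bigr => i _.
rewrite !mulr_sumr raddf_sum; apply: eq_bigr => j _.
rewrite mulrzAl mulrzAr !(raddfMz Phi) mulrzAl mulrzAr.
apply: (congr1 (fun b => b *~ Rnu_coord y j *~ Rnu_coord x i)).
have mC : commutative (@GRing.mul {ffun 'I_nu.+1 -> int}).
  by move=> b c; apply/ffunP => l; rewrite !ffunE mulrC.
wlog ij : i j / (i <= j)%N.
  move=> H; have [|/ltnW] := leqP i j; first exact: H.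
  by move=> /H; rewrite mulrC mC.
have -> : f_Rnu i * f_Rnu j = f_Rnu j *+ p ^ i.
  by apply: val_inj; rewrite raddfMn /= (f_mul pchark ij).
rewrite raddfMn /= !Phi_f; apply/ffunP => l; rewrite ffunMnE !ffunE.
case: (leqP j l) => jl; last by rewrite mulr0 mul0rn.
by rewrite (leq_trans ij jl) -mulr_natl natz.
Qed.
HB.instance Definition _ :=
  GRing.isMonoidMorphism.Build R_ {ffun 'I_nu.+1 -> int} Phi
    Phi_is_monoid_morphism.

Lemma ffunMzE (I : finType) (b : {ffun I -> int}) (n : int) i :
  (b *~ n) i = b i * n.
Proof.
by case: n => n; rewrite ?NegzE ?mulrNz ?ffunE -pmulrn ffunMnE ?mulrN -mulr_natr natz.
Qed.

Lemma Phi_inj : injective Phi.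
Proof.
apply: raddf_inj => x Px0; rewrite (Rnu_coordE x) big1 // => i _.
suff -> : Rnu_coord x i = 0 by rewrite mulr0z.
have [n] := ubnP (i : nat); elim: n i => // n IH i in_.
move/ffunP/(_ i): Px0; rewrite /Phi sum_ffunE (bigD1 i) //= big1 ?addr0.
  rewrite ffunMzE !ffunE leqnn => /eqP; rewrite mulf_eq0 => /orP[|/eqP //].
  by rewrite eqz_nat expn_eq0 eqn0Ngt prime_gt0 // (pcharf_prime pchark).
move=> l li; rewrite ffunMzE ffunE; case: leqP => [le_li|]; last by rewrite mul0r.
by rewrite IH ?mulr0 //; move: li; rewrite -val_eqE /=; lia.
Qed.

(* b_j = b_{j-1} modulo p^j for 1 <= j <= nu, i standing for j - 1. *)
Definition congruence_tuples : {pred {ffun 'I_nu.+1 -> int}} :=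
  [pred b : {ffun 'I_nu.+1 -> int} |
     [forall i : 'I_nu.+1, forall j : 'I_nu.+1,
        (j == i.+1 :> nat) ==> (b j == b i %[mod (p ^ j)%N])%Z]].

End SubringRnu.

Arguments Rnu {k p} nu pchark.
Arguments congruence_tuples p nu : clear implicits.

(* Main.v *)
Require Import Defs.
From mathcomp Require Import all_boot all_order all_algebra.
From mathcomp Require Import zify.

Set Implicit Arguments.
Unset Strict Implicit.
Unset Printing Implicit Defensive.

Import GRing.Theory.
Local Open Scope ring_scope.

(** The congruences define a subring containing every [Phi (f_(p^i))], hence the
    image.  Conversely the equations [b_j = \sum_(i <= j) p^i c_i] are solved by
    [c_0 = b_0] and [c_j = (b_j - b_(j-1)) / p^j], which is an integer exactly
    when the [j]-th congruence holds. *)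

Lemma congruence_tuplesP (p nu : nat) (b : {ffun 'I_nu.+1 -> int}) :
  reflect (forall i j : 'I_nu.+1, j = i.+1 :> nat -> ((p ^ j)%N %| b j - b i)%Z)
          (b \in congruence_tuples p nu).
Proof.
apply: (iffP forallP) => [bP i j ji|bP i].
  by have /forallP/(_ j) := bP i; rewrite ji eqxx eqz_mod_dvd.
apply/forallP => j; apply/implyP => /eqP ji.
by rewrite eqz_mod_dvd bP.
Qed.

Lemma congruence_tuples_subring (p nu : nat) :
  subring_closed (congruence_tuples p nu).
Proof.
split=> [|b c /congruence_tuplesP bP /congruence_tuplesP cP
         |b c /congruence_tuplesP bP /congruence_tuplesP cP];
  apply/congruence_tuplesP => i j ji; rewrite !ffunE.
- by rewrite subrr dvdz0.
- have -> : b j - c j - (b i - c i) = (b j - b i) - (c j - c i) by lia.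
  by rewrite rpredB ?bP ?cP.
(* The usual splitting of a difference of products, so that each summand contains one of the two
   given differences as a factor. *)
- have -> : b j * c j - b i * c i = (b j - b i) * c j + b i * (c j - c i).
    by rewrite mulrBl mulrBr addrA subrK.
  by apply: rpredD; [rewrite dvdz_mulr ?bP | rewrite dvdz_mull ?cP].
Qed.

(** Consecutive entries differ only at the jump from 0 to [p ^ i], which occurs at place [i]
    itself. *)
Lemma Phi_basis_congruence (p nu : nat) (i : 'I_nu.+1) :
  Phi_basis p i \in congruence_tuples p nu.
Proof.
apply/congruence_tuplesP => l j jl; rewrite !ffunE.
have [il|li] := leqP i l; first by rewrite jl (leqW il) subrr dvdz0.
have [ij|_] := leqP i j; last by rewrite subrr dvdz0.
have -> : i = j :> nat by lia.
by rewrite subr0 dvdzz.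
Qed.

(** The system is triangular because [Phi_basis p i] vanishes before place [i]. The bound [i < j.+1]
    is the form that [big_ord_widen] produces. *)
Lemma Phi_coordE (k : fieldType) (p nu : nat) (pchark : p \in [pchar k])
    (x : Rnu nu pchark) (j : 'I_nu.+1) :
  Phi x j = \sum_(i < nu.+1 | (i < j.+1)%N) (p ^ i)%N%:Z * Rnu_coord x i.
Proof.
rewrite /Phi sum_ffunE [RHS]big_mkcond; apply: eq_bigr => i _.
by rewrite ffunMzE ffunE ltnS; case: leqP; rewrite ?mul0rz ?mulrzz.
Qed.

Lemma congruence_quotient_sum (p nu : nat) (b : {ffun 'I_nu.+1 -> int}) :
  b \in congruence_tuples p nu ->
  exists c : nat -> int,
    forall j : 'I_nu.+1, \sum_(i < j.+1) (p ^ i)%N%:Z * c i = b j.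
Proof.
move=> /congruence_tuplesP bP.
(* Indexing [c] by [nat] lets the sums over varying ['I_j.+1] share one function; [inord] is only
   evaluated at indices up to [nu]. *)
exists (fun n => if n is m.+1 then
  ((b (inord n) - b (inord m)) %/ (p ^ n)%N)%Z else b ord0).
case=> n; elim: n => [|n IH] n_lt; rewrite big_ord_recr /=.
  by rewrite big_ord0 add0r expn0 mul1r; congr (b _); apply: val_inj.
have n_lt' := ltnW n_lt.
have En : inord n = Ordinal n_lt' by apply: val_inj; rewrite /= inordK.
have ESn : inord n.+1 = Ordinal n_lt by apply: val_inj; rewrite /= inordK.
(* The sum telescopes: the congruence makes the division exact, so the last term is the full
   increment of [b]. *)
rewrite (IH n_lt') En ESn mulrC divzK; last exact: bP.
by rewrite addrC subrK.
Qed.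

Theorem proposition4p10 (k : fieldType) (p nu : nat) (p_prime : prime p)
    (pchark : p \in [pchar k]) :
  subring_closed (congruence_tuples p nu) /\
  (forall b : {ffun 'I_nu.+1 -> int},
     (exists x : Rnu nu pchark, Phi x = b) <-> b \in congruence_tuples p nu).
Proof.
split=> [|b]; first exact: congruence_tuples_subring.
split=> [[x <-]|/congruence_quotient_sum[c bE]].
  apply/congruence_tuplesP => i j ji; rewrite !sum_ffunE -sumrB.
  apply: rpred_sum => l _; rewrite !ffunMzE -mulrzBl; apply: rpredMz.
  by have /congruence_tuplesP := Phi_basis_congruence p l; apply.
pose x : Rnu nu pchark := \sum_i f_Rnu pchark i *~ [ffun i : 'I_nu.+1 => c i] i.
exists x; apply/ffunP => j; rewrite Phi_coordE -bE.
rewrite (big_ord_widen nu.+1 (fun i => (p ^ i)%N%:Z * c i)) //.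
(* Uniqueness of coordinates in the basis identifies [Rnu_coord x] with [c]. *)
by apply: eq_bigr => i _; rewrite (Rnu_coord_uniq (erefl x)) ffunE.
Qed.
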